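(* Let $\nu>0$, $\lambda>0$, $\eta\in\mathbb{R}\setminus\{0\}$, and let $m=2p+1$ with $p\in\mathbb{N}_0$. Let $F(V,t)=\nu V$ ($V\in\mathbb{R}$, $t>0$), $h(x)=\eta x^m$ and $\Phi(x)=\lambda x$. Then the function $$u(x,t)=u_0(x,t)-\nu\Phi(x)\int_0^tV(\tau)\,d\tau,\qquad x\ge 0,\ t\ge 0,$$ is a solution to Problem P, where $$u_0(x,t)=\frac{\eta}{\sqrt{\pi}}\sum_{k=0}^{p}\binom{m}{2k}\Gamma\!\left(\frac{2k+1}{2}\right)(4t)^kx^{m-2k},\qquad x\ge0,\ t\ge0,$$ and $V(t)=u_x(0,t)$ is given by $V(t)=p_{1,m}(t)-c_{1,m}\exp(-\nu\lambda t)$, $t>0$, with $c_{1,m}$ and $p_{1,m}$ as defined in the context.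
   Context: Problem P: $u_t(x,t)-u_{xx}(x,t)=-\Phi(x)F(u_x(0,t),t)$ for $x>0,t>0$; $u(x,0)=h(x)$ for $x>0$; $u(0,t)=0$ for $t>0$. With $m=2p+1$, put $c=\frac{2^{m-1}m\eta}{\sqrt\pi}\Gamma\left(\frac m2\right)$ ($\Gamma$ the Gamma function), $c_{1,m}=(-1)^{p-1}\dfrac{c\,p!}{(\nu\lambda)^p}$, and $$p_{1,m}(t)=\begin{cases}0 & \text{if }m=1,\\ c_{1,3} & \text{if }m=3,\\ -c_{1,5}(\nu\lambda t-1) & \text{if }m=5,\\ c_{1,m}\Big(\sum_{k=1}^{p-1}\frac{(-\nu\lambda)^k}{k!}t^k+1\Big) & \text{if }m\ge 7.\end{cases}$$ *)

(* Defs.v *)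
From HB Require Import structures.
From mathcomp Require Export all_boot all_order all_algebra.
From mathcomp Require Export all_classical all_reals all_analysis.
Set Implicit Arguments.
Unset Strict Implicit.
Unset Printing Implicit Defensive.
Import Order.TTheory GRing.Theory Num.Theory.
Export numFieldNormedType.Exports.
Local Open Scope classical_set_scope.
Local Open Scope ring_scope.

(** Euler's Gamma function on the positive half-line. *)
Definition Gamma {R : realType} (s : R) : R :=
  \int[lebesgue_measure]_(x in `]0, +oo[) (x `^ (s - 1) * expR (- x)).

Definition right_quotient {R : realType} (f : R -> R) (a h : R) : R :=
  h^-1 * (f (a + h) - f a).

Definition right_derivable {R : realType} (f : R -> R) (a : R) : Prop :=
  cvg (right_quotient f a h @[h --> 0^'+]).

Definition right_derive {R : realType} (f : R -> R) (a : R) : R :=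
  lim (right_quotient f a h @[h --> 0^'+]).

Section ProblemP.
Context {R : realType}.

Definition closed_quadrant : set (R * R) := [set z | 0 <= z.1 /\ 0 <= z.2].
Definition open_quadrant : set (R * R) := [set z | 0 < z.1 /\ 0 < z.2].

(** For a function [u x t], [u x] is a function of the time variable and
    [u ^~ t] a function of the space variable. *)
Definition dt (u : R -> R -> R) (x t : R) : R := derive1 (u x) t.
Definition dx (u : R -> R -> R) (x t : R) : R := derive1 (u ^~ t) x.
Definition dxx (u : R -> R -> R) (x t : R) : R := derive1n 2 (u ^~ t) x.

(** Classical solutions.  They live on the closed quadrant, so the boundary
    flux u_x(0, t) is a one-sided derivative; the values of [u] outside the
    closed quadrant are irrelevant. *)
Record solution_problemP (Phi : R -> R) (F : R -> R -> R) (h : R -> R)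
    (u : R -> R -> R) : Prop := SolutionProblemP {
  sol_continuous :
    {within closed_quadrant, continuous (fun z => u z.1 z.2)};
  sol_derivable_t : forall x t, 0 < x -> 0 < t -> derivable (u x) t 1;
  sol_derivable_x : forall x t, 0 < x -> 0 < t -> derivable (u ^~ t) x 1;
  sol_derivable_xx : forall x t, 0 < x -> 0 < t ->
    derivable (derive1 (u ^~ t)) x 1;
  sol_continuous_dt :
    {within open_quadrant, continuous (fun z => dt u z.1 z.2)};
  sol_continuous_dx :
    {within open_quadrant, continuous (fun z => dx u z.1 z.2)};
  sol_continuous_dxx :
    {within open_quadrant, continuous (fun z => dxx u z.1 z.2)};
  sol_flux : forall t, 0 < t -> right_derivable (u ^~ t) 0;
  sol_equation : forall x t, 0 < x -> 0 < t ->
    dt u x t - dxx u x t = - Phi x * F (right_derive (u ^~ t) 0) t;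
  sol_initial : forall x, 0 < x -> u x 0 = h x;
  sol_boundary : forall t, 0 < t -> u 0 t = 0
}.

End ProblemP.

(** Below, [p] determines the odd exponent m = 2p + 1. *)
Section ExplicitSolution.
Context {R : realType}.
Variables (nu lam eta : R).

Definition coef_c (p : nat) : R :=
  let m := (2 * p).+1 in
  2 ^+ m.-1 * m%:R * eta / Num.sqrt pi * Gamma (m%:R / 2).

(** The exponent p - 1 is an integer: it equals -1 for p = 0. *)
Definition c1 (p : nat) : R :=
  (-1) ^ (p%:Z - 1) * (coef_c p * p`!%:R / (nu * lam) ^+ p).

(** The cases p = 0, 1, 2 and p >= 3 are m = 1, 3, 5 and m >= 7. *)
Definition p1 (p : nat) (t : R) : R :=
  match p with
  | 0%N => 0
  | 1%N => c1 1
  | 2%N => - c1 2 * (nu * lam * t - 1)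
  | _ => c1 p * (\sum_(1 <= k < p) (- (nu * lam)) ^+ k / k`!%:R * t ^+ k + 1)
  end.

Definition flux (p : nat) (t : R) : R :=
  p1 p t - c1 p * expR (- (nu * lam * t)).

Definition u0 (p : nat) (x t : R) : R :=
  let m := (2 * p).+1 in
  eta / Num.sqrt pi *
  \sum_(0 <= k < p.+1)
    'C(m, 2 * k)%:R * Gamma ((2 * k).+1%:R / 2) * (4 * t) ^+ k
      * x ^+ (m - 2 * k).

End ExplicitSolution.

(* Main.v *)
Require Import Defs.
From mathcomp Require Import measurable_realfun zify ring lra.
Set Implicit Arguments.
Unset Strict Implicit.
Unset Printing Implicit Defensive.
Import Order.TTheory GRing.Theory Num.Theory.
Local Open Scope classical_set_scope.
Local Open Scope ring_scope.

(** Write a = nu lam and let c be the constant [coef_c].  The recursion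
    Gamma(s + 1) = s Gamma(s) makes [u0] a caloric polynomial, Gamma(1/2) =
    sqrt pi gives it the initial value eta x^m, and its flux at x = 0 is c t^p.
    For every p, V is a multiple of the difference between the Taylor polynomial
    of degree p - 1 of exp(-a t) and exp(-a t), whence V' = (c t^p)' - a V and
    V(0) = c 0^p.  Integrating, a times the integral of V over [0, t] equals
    c t^p - V(t).  Thus u = u0 - x (c t^p - V) for t >= 0, which has flux V at
    x = 0 and satisfies u_t - u_xx = - a x V. *)

(** * The Gamma function: its recursion and its value at 1/2 *)

Section GammaHalfIntegers.
Context {R : realType}.
Local Notation mu := (@lebesgue_measure R).
Implicit Types (f F : R -> R) (a b s : R).

Lemma continuous_gt0_within f a b : 0 < a ->
  (forall x : R, 0 < x -> {for x, continuous f}) ->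
  {within `[a, b], continuous f}.
Proof.
move=> a0 cf; apply: continuous_in_subspaceT => x.
by rewrite inE/= in_itv/= => /andP[ax _]; apply: cf; exact: lt_le_trans ax.
Qed.

Lemma derivable_closed_LRcontinuous F a b :
  (forall x, a <= x -> derivable F x 1) -> a <= b ->
  derivable_oo_LRcontinuous F a b.
Proof.
move=> dF ab; have cF x : a <= x -> {for x, continuous F}.
  by move=> ax; apply: differentiable_continuous; exact/derivable1_diffP/dF.
split=> [x||].
- by rewrite in_itv/= => /andP[ax _]; apply: dF; exact: ltW.
- by apply: cvg_at_right_filter; exact: cF.
- by apply: cvg_at_left_filter; exact: cF.
Qed.

(** Monotone convergence, as the intervals increase to the open half-line. Calculus on compact
    intervals away from 0 thus reaches improper integrals. *)
Lemma cvg_integral_itv_invr f (b : R^nat) :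
  (forall x : R, 0 < x -> {for x, continuous f}) ->
  (forall x : R, 0 < x -> 0 <= f x) ->
  (forall n, 0 < b n) -> nondecreasing_seq b -> b n @[n --> \oo] --> +oo%R ->
  (\int[mu]_(x in `[(b n)^-1%R, b n]) (f x)%:E @[n --> \oo]
    --> \int[mu]_(x in `]0%R, +oo[) (f x)%:E)%E.
Proof.
move=> cf f0 b0 ndb boo.
have -> : `]0, +oo[%classic = \bigcup_n `[(b n)^-1, b n]%classic :> set R.
  apply/seteqP; split=> x /=.
    rewrite in_itv/= andbT => x0.
    have [n _ xb] : \forall n \near \oo, Num.max x x^-1 <= b n.
      by move/cvgryPge: boo; exact.
    exists n => //=; have := xb n (leqnn n); rewrite ge_max => /andP[xn x'n].
    by rewrite in_itv/= xn andbT -[x]invrK lef_pV2 ?posrE ?invr_gt0.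
  move=> [n _] /=; rewrite !in_itv/= andbT => /andP[+ _].
  by apply: lt_le_trans; rewrite invr_gt0.
apply: (@ge0_nondecreasing_set_cvg_integral _ (measurableTypeR R)
  R (fun n => `[(b n)^-1, b n]%classic) (EFin \o f) mu) => //.
- move=> m n mn; rewrite subsetEset; apply: subset_itv; rewrite bnd_simp.
    by rewrite lef_pV2 ?posrE// ndb.
  exact: ndb.
- move=> n; apply/measurable_EFinP.
  apply: subspace_continuous_measurable_fun => //.
  by apply: continuous_gt0_within => //; rewrite invr_gt0.
- move=> n x /=; rewrite in_itv/= lee_fin => /andP[+ _] => bx; apply: f0.
  by apply: lt_le_trans bx; rewrite invr_gt0.
Qed.

Lemma continuous_powR s (x : R) : 0 < x -> {for x, continuous (@powR R ^~ s)}.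
Proof.
move=> x0; apply: differentiable_continuous; apply/derivable1_diffP.
by have [] := is_derive1_powR s x0.
Qed.

Lemma continuous_powR_expRN s (x : R) : 0 < x ->
  {for x, continuous (fun y : R => y `^ s * expR (- y))}.
Proof.
move=> x0; apply: continuousM; first exact: continuous_powR.
apply: (@continuous_comp _ _ _ -%R expR); first exact: continuousN.
exact: continuous_expR.
Qed.

(** For an integer N >= s and x >= 1, the bound exp x >= x^(N+1) / (N+1)! gives x^s exp(-x) <=
    (N+1)! / x; below, N = [n.+1]. *)
Lemma cvg_powR_expRN s : x `^ s * expR (- x) @[x --> +oo%R] --> (0 : R).
Proof.
pose n := Num.trunc `|s|.
have sn : s <= n.+1%:R.
  by apply: le_trans (ler_norm s) _; apply/ltW; exact: truncnS_gt.
apply: (@squeeze_cvgr _ _ _ _ (fun=> 0) (fun x : R => n.+2`!%:R * x^-1)).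
- near=> x; have x1 : 1 <= x by near: x; exact: nbhs_pinfty_ge.
  have x0 : 0 < x by exact: lt_le_trans x1.
  rewrite mulr_ge0 ?powR_ge0 ?expR_ge0//= expRN ler_pdivrMr ?expR_gt0//.
  apply: (@le_trans _ _ (x ^+ n.+1)); first
    by rewrite -(powR_mulrn n.+1 (ltW x0)) ler_powR.
  rewrite mulrAC -mulrA -ler_pdivrMl ?ltr0n ?fact_gt0//.
  rewrite ler_pdivlMr// -mulrA -exprSr mulrC.
  by apply: le_trans (expR_ge1Dxn n.+1 (ltW x0)); rewrite lerDr.
- exact: cvg_cst.
- rewrite -[X in _ --> X](mulr0 n.+2`!%:R); apply: cvgMr.
  apply/gtr0_cvgV0; last exact: cvg_id.
  by near=> x; near: x; exact: nbhs_pinfty_gt.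
Unshelve. all: by end_near. Qed.

Lemma cvg_powR_expRN0 s : 0 < s ->
  x `^ s * expR (- x) @[x --> 0^'+] --> (0 : R).
Proof.
move=> s0; rewrite -[X in _ --> X](mul0r (expR (- 0))).
apply: cvgM; first exact: powR_cvg0.
apply: cvg_at_right_filter; apply: (@continuous_comp _ _ _ -%R expR).
  exact: continuousN.
exact: continuous_expR.
Qed.

Local Notation gamma_integral s :=
  (\int[mu]_(x in `]0%R, +oo[) (x `^ s * expR (- x))%:E)%E.

Lemma cvgn_natr_shift2 : (n.+2%:R : R) @[n --> \oo] --> +oo%R.
Proof.
apply/cvgryPge => A; near=> n.
apply: (@le_trans _ _ n%:R); last by rewrite ler_nat ltnW.
by near: n; exact: nbhs_infty_ger.
Unshelve. all: by end_near. Qed.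

(** An identity in the extended reals, so that no finiteness of the integrals is
    required. *)
Lemma gamma_integralS s : 0 < s ->
  gamma_integral s = (s%:E * gamma_integral (s - 1))%E.
Proof.
(* The shift by 2 gives [b n] > 1, so that [1/b n, b n] is nondegenerate. *)
move=> s0; pose b n : R := n.+2%:R.
have b1 n : 1 < b n by rewrite ltr1n.
have b0 n : 0 < b n by exact: lt_trans (b1 n).
have ndb : nondecreasing_seq b by move=> m n mn; rewrite ler_nat.
have boo : b n @[n --> \oo] --> +oo%R by exact: cvgn_natr_shift2.
pose f r (x : R) := x `^ r * expR (- x).
have cvgf r : (\int[mu]_(x in `[(b n)^-1%R, b n]) (f r x)%:E @[n --> \oo]
    --> gamma_integral r)%E.
  apply: cvg_integral_itv_invr => // x x0; first exact: continuous_powR_expRN.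
  by rewrite mulr_ge0 ?powR_ge0 ?expR_ge0.
have Vb n : 0 < (b n)^-1 by rewrite invr_gt0.
have parts n : (\int[mu]_(x in `[(b n)^-1%R, b n]) (f s x)%:E =
    (f s (b n)^-1 - f s (b n))%:E +
    s%:E * \int[mu]_(x in `[(b n)^-1%R, b n]) (f (s - 1) x)%:E)%E.
  have itv0 (x : R) : (b n)^-1 <= x -> 0 < x by exact: lt_le_trans.
  have ab : (b n)^-1 < b n by rewrite (lt_trans _ (b1 n))// invf_lt1.
  rewrite (@integration_by_parts R (@powR R ^~ s) (fun x => - expR (- x))
    (fun x => s * x `^ (s - 1)) (fun x => expR (- x)) (b n)^-1 (b n)) //;
    first last.
  - move=> x _; rewrite derive1E.
    by rewrite derive_val/=; ring.
  - apply: derivable_closed_LRcontinuous; last exact: ltW.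
    by move=> x _; exact: ex_derive.
  - apply: continuous_gt0_within => // x _.
    apply: (@continuous_comp _ _ _ -%R expR); first exact: continuousN.
    exact: continuous_expR.
  - move=> x; rewrite in_itv/= => /andP[/ltW/itv0 x0 _].
    by rewrite derive1E; apply: derive_val; exact: is_derive1_powR.
  - apply: derivable_closed_LRcontinuous; last exact: ltW.
    by move=> x /itv0 x0; have [] := is_derive1_powR s x0.
  - apply: continuous_gt0_within => // x x0.
    by apply: continuousM; [exact: cst_continuous|exact: continuous_powR].
  have mf : measurable_fun `[(b n)^-1, b n] (EFin \o f (s - 1)).
    apply/measurable_EFinP; apply: subspace_continuous_measurable_fun => //.
    by apply: continuous_gt0_within => // x; exact: continuous_powR_expRN.
  have f0 x : 0 <= f (s - 1) x by rewrite mulr_ge0 ?powR_ge0 ?expR_ge0.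
  rewrite -ge0_integralZl_EFin ?ltW//; last by move=> x _; rewrite lee_fin.
  congr (_ + _)%E; first by congr EFin; rewrite /f; ring.
  (* The sign from the primitive -exp(-x) is moved inside the integral, which nonnegativity of s
     x^(s-1) exp(-x) permits. *)
  rewrite -[LHS]oppeK oppeK -[RHS]oppeK -integral_ge0N; last first.
    by move=> x _; rewrite -EFinM lee_fin mulr_ge0// ltW.
  congr (- _)%E.
  apply: eq_integral => x _; rewrite -EFinM -EFinN; congr EFin.
  by rewrite /f; ring.
(* The boundary terms vanish at both ends; at 0 this uses s > 0. *)
have flim0 : f s (b n)^-1 - f s (b n) @[n --> \oo] --> (0 : R).
  rewrite -[X in _ --> X]subr0; apply: cvgB.
    have /cvg_at_rightP := cvg_powR_expRN0 s0; apply; split=> //.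
    by apply/gtr0_cvgV0 => //; exact: nearW.
  by have /cvg_pinftyP := @cvg_powR_expRN s; exact.
rewrite -[RHS]add0e -(cvg_lim _ (cvgf s))//; apply/cvg_lim => //.
under eq_cvg do rewrite parts.
apply: cvgeD => //.
- by apply: cvg_EFin; [exact: nearW|exact: flim0].
- exact: cvgeZl.
Qed.

Lemma GammaS s : 0 < s -> Gamma (s + 1) = s * Gamma s.
Proof.
move=> s0; rewrite /Gamma /Rintegral addrK gamma_integralS//.
have : (0 <= gamma_integral (s - 1))%E.
  by apply: integral_ge0 => x _; rewrite lee_fin mulr_ge0 ?powR_ge0 ?expR_ge0.
case: (gamma_integral (s - 1)) => [r _||//]; first by rewrite -EFinM.
(* For an infinite integral, both real-valued integrals take the default value 0. *)
by rewrite gt0_muley ?lte_fin//= mulr0.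
Qed.

(** x = y^2 turns the integrand into twice the Gaussian; on truncated intervals
    the substitution avoids the singularity of x^(-1/2) at 0. *)
Lemma Gamma_half : Gamma (2^-1) = Num.sqrt pi :> R.
Proof.
rewrite /Gamma /Rintegral.
have -> : 2^-1 - 1 = - 2^-1 :> R by lra.
suff -> : gamma_integral (- 2^-1) = (Num.sqrt pi)%:E by [].
pose b n : R := n.+2%:R.
have b1 n : 1 < b n by rewrite ltr1n.
have b0 n : 0 < b n by exact: lt_trans (b1 n).
have ndb : nondecreasing_seq b by move=> m n mn; rewrite ler_nat.
have boo : b n @[n --> \oo] --> +oo%R by exact: cvgn_natr_shift2.
(* The endpoints are squared because y -> y^2 maps [1/b n, b n] onto this interval. *)
have cvgG : (\int[mu]_(x in `[(b n ^+ 2)^-1%R, (b n ^+ 2)%R])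
    (x `^ (- 2^-1) * expR (- x))%:E @[n --> \oo]
    --> gamma_integral (- 2^-1))%E.
  apply: cvg_integral_itv_invr => // [x|x|n|m n|].
  - exact: continuous_powR_expRN.
  - by move=> _; rewrite mulr_ge0 ?powR_ge0 ?expR_ge0.
  - by rewrite exprn_gt0.
  - by move=> mn; rewrite lerXn2r ?nnegrE ?(ltW (b0 _))//; exact: ndb.
  - apply/cvgryPge => A; near=> n; apply: (@le_trans _ _ (b n)).
      by near: n; move/cvgryPge: boo; exact.
    by rewrite expr2 ler_peMl// ltW.
have cvgE : (\int[mu]_(x in `[(b n)^-1%R, b n]) (gauss_fun x)%:E @[n --> \oo]
    --> (Num.sqrt pi / 2)%:E)%E.
  rewrite -integral0y_gauss -integral_itv_obnd_cbnd; last first.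
    apply/measurable_EFinP; apply: measurable_funTS.
    exact: measurable_gauss_fun.
  apply: cvg_integral_itv_invr => // x _; last exact: gauss_fun_ge0.
  exact: continuous_gauss_fun.
have subst n : (\int[mu]_(x in `[(b n ^+ 2)^-1%R, (b n ^+ 2)%R])
      (x `^ (- 2^-1) * expR (- x))%:E =
   2%:E * \int[mu]_(x in `[(b n)^-1%R, b n]) (gauss_fun x)%:E)%E.
  have Vb : 0 < (b n)^-1 by rewrite invr_gt0.
  have dsqr : (fun y : R => y ^+ 2)^`()%classic = fun y => 2 * y.
    apply/funext => y.
    by rewrite derive1E derive_val/= scaler1 mulr_natl mulr2n.
  have ab : (b n)^-1 < b n by rewrite (lt_trans _ (b1 n))// invf_lt1.
  have csqr : continuous (fun y : R => 2 * y) by exact: mulrl_continuous.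
  rewrite -exprVn (@integration_by_substitution_increasing R (fun y => y ^+ 2)
    (fun x => x `^ (- 2^-1) * expR (- x)) (b n)^-1 (b n) (ltW ab)).
  - rewrite -ge0_integralZl_EFin//; last 2 first.
    + by move=> x _; rewrite lee_fin gauss_fun_ge0.
    + apply/measurable_EFinP; apply: measurable_funTS.
      exact: measurable_gauss_fun.
    apply: eq_integral => x; rewrite inE/= in_itv/= => /andP[ax _].
    have x0 : 0 < x by exact: lt_le_trans ax.
    rewrite -EFinM dsqr; congr EFin; rewrite /gauss_fun !fctE.
    (* Here (x^2)^(-1/2) = 1/x cancels the x of the Jacobian 2x. *)
    rewrite powRN powR12_sqrt ?sqr_ge0// sqrtr_sqr gtr0_norm//.
    by field; rewrite gt_eqF.
  - move=> x y; rewrite !in_itv/= => /andP[ax _] /andP[ay _] xy.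
    rewrite ltr_pXn2r// nnegrE ltW//; first exact: lt_le_trans ax.
    exact: lt_le_trans ay.
  - move=> x _; rewrite dsqr.
    exact: csqr.
  - rewrite dsqr.
    apply/cvg_ex; exists (2 * (b n)^-1).
    by apply: cvg_at_right_filter; exact: csqr.
  - rewrite dsqr.
    apply/cvg_ex; exists (2 * b n).
    by apply: cvg_at_left_filter; exact: csqr.
  - apply: derivable_closed_LRcontinuous; last exact: ltW.
    by move=> x _; exact: ex_derive.
  - apply: continuous_gt0_within; first by rewrite exprn_gt0.
    exact: continuous_powR_expRN.
have -> : ((Num.sqrt pi)%:E = 2%:E * (Num.sqrt pi / 2)%:E :> \bar R)%E.
  by rewrite -EFinM; congr EFin; field.
apply: (cvg_unique _ cvgG) => //.
rewrite (_ : (fun n => _) = fun n =>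
  2%:E * \int[mu]_(x in `[(b n)^-1%R, b n]) (gauss_fun x)%:E)%E;
  last exact/funext.
exact: cvgeZl.
Unshelve. all: by end_near. Qed.

End GammaHalfIntegers.

(** * Finite sums of monomials: derivatives and joint continuity *)

Section MonomialSums.
Context {R : realType}.
Implicit Types (c : nat -> R) (e : nat -> nat).

(** The sum is the evaluation of a polynomial. Where [e k] = 0, the truncated predecessor is
    harmless because the factor [e k] vanishes. *)
Lemma is_derive_monomials n c e (x : R) :
  is_derive x 1 (fun y => \sum_(0 <= k < n) c k * y ^+ e k)
    (\sum_(0 <= k < n) c k * (e k)%:R * x ^+ (e k).-1).
Proof.
pose q : {poly R} := \sum_(0 <= k < n) c k *: 'X^(e k).
have qE : horner q = fun y => \sum_(0 <= k < n) c k * y ^+ e k.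
  apply/funext => y; rewrite /q horner_sum; apply: eq_bigr => k _.
  by rewrite hornerZ hornerXn.
have q'E : q^`().[x] = \sum_(0 <= k < n) c k * (e k)%:R * x ^+ (e k).-1.
  rewrite /q (raddf_sum (@deriv R)) horner_sum; apply: eq_bigr => k _.
  by rewrite /= derivZ derivXn hornerZ hornerMn hornerXn -mulrA mulr_natl.
by rewrite -qE -q'E; exact: is_derive_poly.
Qed.

Lemma continuous_monomials2 n c (d e : nat -> nat) :
  continuous (fun z : R * R =>
    \sum_(0 <= k < n) c k * z.2 ^+ d k * z.1 ^+ e k).
Proof.
move=> z; elim: n => [|n IHn].
  rewrite /continuous_at big_nil; under eq_fun do rewrite big_nil.
  exact: cvg_cst.
rewrite /continuous_at big_nat_recr//=; under eq_fun do rewrite big_nat_recr//=.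
apply: cvgD; first exact: IHn.
apply: cvgM; first apply: cvgM; first exact: cvg_cst.
  by apply: (@continuous_comp _ _ _ snd (@GRing.exp R ^~ (d n)));
    [exact: cvg_snd|exact: exprn_continuous].
by apply: (@continuous_comp _ _ _ fst (@GRing.exp R ^~ (e n)));
    [exact: cvg_fst|exact: exprn_continuous].
Qed.

End MonomialSums.

(** * The flux: closed form, differential equation and primitive *)

Section Flux.
Context {R : realType}.
Variables (nu lam eta : R) (p : nat).
Hypotheses (nu_gt0 : 0 < nu) (lam_gt0 : 0 < lam).
Let a := nu * lam.
Let c := coef_c eta p.
Let V := flux nu lam eta p.

Let a_neq0 : a != 0. Proof. by rewrite mulf_neq0 ?gt_eqF. Qed.

(** The four cases of [p1] are one formula: the sum is empty for p = 0, is 1 for p = 1 and 1 - a t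
    for p = 2; for p >= 3 its term k = 0 is the separate 1. *)
Lemma fluxE t : V t = c1 nu lam eta p *
  (\sum_(0 <= k < p) (- a) ^+ k / k`!%:R * t ^+ k - expR (- (a * t))).
Proof.
rewrite /V /flux /p1 [RHS]mulrBr; congr (_ - _).
case: p => [|[|[|q]]].
- by rewrite big_nil mulr0.
- by rewrite big_nat1 !expr0 fact0 divr1 !mulr1.
- rewrite big_nat_recr// big_nat1 !expr0 fact0 !factS fact0 muln1 !divr1.
  by rewrite !expr1 /a /=; ring.
- by rewrite [in RHS]big_ltn// !expr0 fact0 divr1 mulr1 addrC.
Qed.

(** For p > 0 the bracket is 1 - 1. For p = 0 the sum is empty and [c1] is -c, which leaves c, in
    line with 0^0 = 1. *)
Lemma flux0 : V 0 = c * 0 ^+ p.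
Proof.
rewrite fluxE mulr0 oppr0 expR0 /c1 /c.
case: p => [|q].
  rewrite big_nil !sub0r exprN1 invrN1 !expr0 fact0 divr1 mulr1.
  by rewrite mulN1r mulrNN mulr1.
rewrite big_ltn// big1_seq ?expr0 ?fact0 => [|k /andP[_]].
  by rewrite divr1 mulr1 addr0 subrr mulr0 expr0n mulr0.
rewrite mem_index_iota => /andP[k0 _].
by rewrite expr0n eqn0Ngt k0 mulr0.
Qed.

(** For the Taylor polynomial T of exp(-a t), T' + a T reduces to a times the top term of T; [c1] is
    scaled to turn this into (c t^p)'. *)
Lemma c1_exp_sum t : c1 nu lam eta p *
  (\sum_(0 <= k < p) (- a) ^+ k / k`!%:R * k%:R * t ^+ k.-1 +
   a * \sum_(0 <= k < p) (- a) ^+ k / k`!%:R * t ^+ k) = c * p%:R * t ^+ p.-1.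
Proof.
rewrite /c /c1; case: p => [|q].
  by rewrite !big_nil !mulr0 addr0 mulr0 mul0r.
have telescope :
    \sum_(0 <= k < q) (- a) ^+ k.+1 / k.+1`!%:R * k.+1%:R * t ^+ k +
    a * \sum_(0 <= k < q) (- a) ^+ k / k`!%:R * t ^+ k = 0.
  rewrite mulr_sumr -big_split/= big1// => k _.
  rewrite factS natrM exprS; field.
  by rewrite nat1r !pnatr_eq0 -lt0n fact_gt0.
rewrite big_nat_recl// mulr0 mul0r add0r big_nat_recr//= (mulrDr a) addrA.
rewrite telescope add0r.
(* For p = q + 1 the integer exponent of -1 in [c1] is the natural number q. *)
have -> : Posz q.+1 - 1 = q by rewrite -addn1 PoszD addrK.
rewrite -/a -exprnP (exprNn a) (exprS a) factS natrM.
(* One sign comes from [c1], the other from (-a)^q. *)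
transitivity ((-1) ^+ q * (-1) ^+ q * (coef_c eta q.+1 * q.+1%:R * t ^+ q)).
  field.
  by rewrite pnatr_eq0 -lt0n fact_gt0 /= expf_neq0.
by rewrite -expr2 sqrr_sign mul1r.
Qed.

(** Since exp(-a t) is annihilated by d/dt + a, only the Taylor polynomial contributes to V' + a
    V. *)
Lemma is_derive_flux (t : R) : is_derive t 1 V (c * p%:R * t ^+ p.-1 - a * V t).
Proof.
have dS := is_derive_monomials p (fun k => (- a) ^+ k / k`!%:R) id t.
have dg : is_derive t 1 (fun y : R => - (a * y)) (- a).
  have := is_deriveN (is_deriveZ a (is_derive_id t 1)).
  by rewrite /GRing.scale/= mulr1.
have dE := @is_derive1_comp R expR (fun y => - (a * y)) t _ _
  (is_derive_expR _) dg.
have -> : V = _ := funext fluxE.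
apply: (is_derive_eq (is_deriveZ (c1 nu lam eta p) (is_deriveB dS dE))).
rewrite -c1_exp_sum /GRing.scale/=; ring.
Qed.

(** Solving the differential equation for [V] exhibits [V] as the derivative of this function, which
    vanishes at 0 by [flux0]. *)
Let W t := (c * t ^+ p - V t) / a.

Lemma is_derive_flux_primitive (t : R) : is_derive t 1 W (V t).
Proof.
have dp : is_derive t 1 (fun y => c * y ^+ p) (c * p%:R * t ^+ p.-1).
  have := is_derive_monomials 1 (fun=> c) (fun=> p) t.
  by under eq_fun do rewrite big_nat1; rewrite big_nat1.
have -> : W = a^-1 \*: ((fun y => c * y ^+ p) - V).
  by apply/funext => y; rewrite /W mulrC.
apply: (is_derive_eq (is_deriveZ a^-1 (is_deriveB dp (is_derive_flux t)))).
by rewrite /GRing.scale/=; field.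
Qed.

Lemma continuous_flux : continuous V.
Proof.
move=> t; apply: differentiable_continuous; apply/derivable1_diffP.
by have [] := is_derive_flux t.
Qed.

Lemma integral_flux t : 0 <= t ->
  \int[lebesgue_measure]_(tau in `[0, t]) V tau = (c * t ^+ p - V t) / a.
Proof.
have W0 : W 0 = 0 by rewrite /W flux0 subrr mul0r.
(* The fundamental theorem of calculus is applied for t > 0; at t = 0 both sides are 0. *)
rewrite -/(W t) le_eqVlt => /predU1P[<-|t0].
  by rewrite set_itv1 /Rintegral integral_set1 W0.
rewrite /Rintegral (@continuous_FTC2 R V W 0 t t0) ?W0 ?sube0//.
- by apply: continuous_subspaceT => y; exact: continuous_flux.
- apply: derivable_closed_LRcontinuous; last exact: ltW.
  by move=> y _; have [] := is_derive_flux_primitive y.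
- move=> y _; rewrite derive1E.
  by have [_ ->] := is_derive_flux_primitive y.
Qed.

End Flux.

(** * The caloric polynomial [u0] and its boundary data *)

Section HeatPolynomial.
Context {R : realType}.
Variables (eta : R) (p : nat).
Let m := (2 * p).+1.

Definition u0_coef k : R := eta / Num.sqrt pi *
  ('C((2 * p).+1, 2 * k)%:R * Gamma ((2 * k).+1%:R / 2) * 4 ^+ k).

(** Termwise derivatives. Since 2k < m for k <= p, the differences are genuine, and wherever a
    predecessor truncates, a coefficient factor is 0. *)
Definition u0t (x t : R) : R :=
  \sum_(0 <= k < p.+1) u0_coef k * k%:R * t ^+ k.-1 * x ^+ (m - 2 * k).
Definition u0x (x t : R) : R :=
  \sum_(0 <= k < p.+1)
    u0_coef k * (m - 2 * k)%:R * t ^+ k * x ^+ (m - 2 * k).-1.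
Definition u0xx (x t : R) : R :=
  \sum_(0 <= k < p.+1)
    u0_coef k * (m - 2 * k)%:R * (m - 2 * k).-1%:R * t ^+ k
      * x ^+ (m - 2 * k).-2.

Lemma u0E x t : u0 eta p x t =
  \sum_(0 <= k < p.+1) u0_coef k * t ^+ k * x ^+ (m - 2 * k).
Proof.
rewrite /u0 mulr_sumr; apply: eq_bigr => k _.
by rewrite /u0_coef exprMn; ring.
Qed.

Lemma is_derive_u0t (x t : R) : is_derive t 1 (u0 eta p x) (u0t x t).
Proof.
have := is_derive_monomials p.+1 (fun k => u0_coef k * x ^+ (m - 2 * k)) id t.
congr is_derive.
  by apply/funext => y; rewrite u0E; apply: eq_bigr => k _; ring.
by apply: eq_bigr => k _; ring.
Qed.

Lemma is_derive_u0x (x t : R) : is_derive x 1 (u0 eta p ^~ t) (u0x x t).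
Proof.
have := is_derive_monomials p.+1 (fun k => u0_coef k * t ^+ k)
  (fun k => m - 2 * k)%N x.
congr is_derive.
  by apply/funext => y; rewrite u0E; apply: eq_bigr => k _; ring.
by apply: eq_bigr => k _; ring.
Qed.

Lemma is_derive_u0xx (x t : R) : is_derive x 1 (u0x ^~ t) (u0xx x t).
Proof.
have := is_derive_monomials p.+1 (fun k => u0_coef k * (m - 2 * k)%:R * t ^+ k)
  (fun k => (m - 2 * k).-1)%N x.
congr is_derive.
by apply: eq_bigr => k _; ring.
Qed.

(** Two uses of (j+1) C(m,j+1) = (m-j) C(m,j), at j = 2k+1 and j = 2k, supply the factors
    (m-2k)(m-2k-1). The Gamma recursion gives (2k+1)/2, and 4 (k+1) (2k+1)/2 = (2k+2)(2k+1). *)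
Lemma u0_coefS k : (k < p)%N -> u0_coef k.+1 * k.+1%:R =
  u0_coef k * (m - 2 * k)%:R * (m - 2 * k).-1%:R.
Proof.
move=> kp; have bin2 : ('C(m, 2 * k.+1) * (2 * k.+1) * (2 * k).+1 =
    'C(m, 2 * k) * (m - 2 * k) * (m - 2 * k).-1)%N.
  rewrite (_ : 2 * k.+1 = (2 * k).+2)%N; last by lia.
  rewrite (mulnC 'C(_, _)) mul_bin_left subnS -mulnA.
  rewrite (mulnC 'C(_, _)) mul_bin_left.
  by rewrite mulnC (mulnC (m - _)%N).
have GS : Gamma ((2 * k.+1).+1%:R / 2) =
    (2 * k).+1%:R / 2 * Gamma ((2 * k).+1%:R / 2) :> R.
  rewrite -GammaS ?divr_gt0 ?ltr0n//; congr Gamma.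
  by rewrite mulnS -addn1 -(addn1 (2 * k)) !natrD; field.
rewrite /u0_coef -/m GS exprS.
have /(congr1 (fun n => n%:R : R)) := bin2.
rewrite !natrM => {}bin2.
transitivity (eta / Num.sqrt pi * (Gamma ((2 * k).+1%:R / 2) * 4 ^+ k) *
  ('C(m, 2 * k.+1)%:R * (2 * k.+1%:R) * (2 * k).+1%:R)).
  by field; rewrite gt_eqF// sqrtr_gt0 pi_gt0.
by rewrite bin2; ring.
Qed.

(** The term k = 0 is constant in t and the term k = p is linear in x, so each drops out of one
    side; the others match after a shift of k. *)
Lemma u0_heat x t : u0t x t = u0xx x t.
Proof.
rewrite /u0t /u0xx big_nat_recl// mulr0 !mul0r add0r [RHS]big_nat_recr//=.
rewrite [X in _ = _ + X](_ : _ = 0) ?addr0; last by rewrite subSnn mulr0 !mul0r.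
apply: eq_big_nat => k /andP[_ kp]; rewrite u0_coefS//; congr (_ * _ ^+ _).
by rewrite mulnS; lia.
Qed.

(** Only k = p gives a monomial linear in x; its coefficient is c because C(m,m-1) = m and 4^p =
    2^(m-1). *)
Lemma u0x0 t : u0x 0 t = coef_c eta p * t ^+ p.
Proof.
rewrite /u0x big_nat_recr//= big1_seq ?add0r => [|k /andP[_]].
  rewrite subSnn expr0 !mulr1 /u0_coef /coef_c; congr (_ * _).
  rewrite binSn.
  by rewrite exprM (_ : 2 ^+ 2 = 4 :> R); ring.
rewrite mem_index_iota => /andP[_ kp].
by rewrite expr0n (_ : _ == _ = false) ?mulr0//; lia.
Qed.

(** Only k = 0 survives, and Gamma(1/2) cancels the normalisation by sqrt pi. *)
Lemma u0_initial x : u0 eta p x 0 = eta * x ^+ m.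
Proof.
rewrite u0E big_nat_recl// big1_seq ?addr0 => [|k _]; last first.
  by rewrite exprS mul0r mulr0 mul0r.
rewrite /u0_coef muln0 bin0 subn0 expr0 !mulr1 mul1r mul1r Gamma_half.
by rewrite divfK// gt_eqF// sqrtr_gt0 pi_gt0.
Qed.

Lemma u0_boundary t : u0 eta p 0 t = 0.
Proof.
rewrite u0E big1_seq// => k /andP[_].
rewrite mem_index_iota ltnS => /andP[_ kp].
by rewrite expr0n (_ : _ == _ = false) ?mulr0//; lia.
Qed.

End HeatPolynomial.

(** * One-sided derivatives and continuity on subsets *)

Lemma is_derive_right_cvg (R : realType) (f : R -> R) (a d : R) :
  is_derive a 1 f d -> right_quotient f a h @[h --> 0^'+] --> d.
Proof.
move=> [df <-].
have dq : h^-1 *: ((f \o shift a) (h *: 1) - f a) @[h --> 0^'] --> 'D_1 f a.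
  exact: df.
have -> : right_quotient f a =
    fun h => h^-1 *: ((f \o shift a) (h *: 1) - f a).
  by apply/funext => h; rewrite /right_quotient/= [h *: 1]mulr1 (addrC a).
exact: cvg_dnbhs_at_right.
Qed.

(** Needed because the closed form of the integral of [V] is available for t >= 0 only: continuous
    formulas replace [u] and its derivatives on the quadrants. *)
Lemma within_eq_continuous (T S : topologicalType) (f g : T -> S) (A : set T) :
  (forall z, A z -> f z = g z) -> continuous f -> {within A, continuous g}.
Proof.
move=> fg cf; apply: (@subspace_eq_continuous _ A _ f); last first.
  exact: continuous_subspaceT.
by move=> z; rewrite inE; exact: fg.
Qed.

(** * Verification of the solution properties *)

Theorem proposition2p5 (R : realType) (nu lam eta : R) (m p : nat)
    (nu_gt0 : (0 < nu)%R) (lam_gt0 : (0 < lam)%R) (eta_neq0 : eta != 0%R)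
    (mE : m = (2 * p + 1)%N) :
  let F := fun W t : R => nu * W in
  let h := fun x : R => eta * x ^+ m in
  let Phi := fun x : R => lam * x in
  let V := flux nu lam eta p in
  let u := fun x t : R =>
    u0 eta p x t
      - nu * Phi x * (\int[lebesgue_measure]_(tau in `[0, t]) V tau) in
  solution_problemP Phi F h u /\
  (forall t : R, 0 < t -> right_derive (u ^~ t) 0 = V t).
Proof.
move=> F h Phi V u.
pose a := nu * lam; pose c := coef_c eta p.
have a0 : a != 0 by rewrite mulf_neq0 ?gt_eqF.
pose J t := \int[lebesgue_measure]_(tau in `[0, t]) V tau.
have JE t : 0 <= t -> a * J t = c * t ^+ p - V t.
  by move=> t0; rewrite /J integral_flux// mulrC divfK.
have duxx (x t : R) :
    is_derive x 1 (fun y => u0x eta p y t - a * J t) (u0xx eta p x t).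
  have := is_deriveB (is_derive_u0xx eta p x t) (is_derive_cst (a * J t) x 1).
  by rewrite subr0.
(* For fixed t, [u] is a polynomial in x on the whole line, so its flux at 0 comes from a two-sided
   derivative. *)
have dux (x t : R) : is_derive x 1 (u ^~ t) (u0x eta p x t - a * J t).
  have := is_deriveB (is_derive_u0x eta p x t)
    (is_deriveZ (a * J t) (is_derive_id x (1 : R))).
  rewrite [(a * J t) *: _]mulr1; congr is_derive.
  apply/funext => y; rewrite /u /Phi -/(J t).
  transitivity (u0 eta p y t - a * J t * y); first by [].
  by rewrite /a; ring.
have dut (x t : R) : 0 < t -> is_derive t 1 (u x) (u0t eta p x t - a * x * V t).
  move=> t0.
  have dW := is_derive_flux_primitive eta p nu_gt0 lam_gt0 t.
  have := is_deriveB (is_derive_u0t eta p x t) (is_deriveZ (a * x) dW).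
  apply: near_eq_is_derive.
  (* As t > 0, nearby s are positive too and the closed form of the integral holds there. *)
  near=> s; have s0 : 0 < s by near: s; exact: lt_nbhsr.
  rewrite /u /Phi -/(J s) /J integral_flux ?ltW//.
  transitivity (u0 eta p x s - a * x * ((c * s ^+ p - V s) / a)); first by [].
  by congr (_ - _ * _); rewrite /a mulrA.
have dxE t : dx u ^~ t = fun x => u0x eta p x t - a * J t.
  by apply/funext => x; rewrite /dx derive1E; exact: derive_val.
have dxxE x t : dxx u x t = u0xx eta p x t.
  rewrite /dxx /derive1n/= -[derive1 (u ^~ t)]/(dx u ^~ t) dxE derive1E.
  exact: derive_val.
have dtE x t : 0 < t -> dt u x t = u0t eta p x t - a * x * V t.
  by move=> t0; rewrite /dt derive1E; have [_ ->] := dut x t t0.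
have rd t : 0 < t -> right_quotient (u ^~ t) 0 h @[h --> 0^'+] --> V t.
  move=> t0; have := is_derive_right_cvg (dux 0 t).
  (* The flux of [u] is c t^p - (c t^p - V), that is, V. *)
  by rewrite JE ?ltW// u0x0 subKr.
have rdE t : 0 < t -> right_derive (u ^~ t) 0 = V t.
  by move=> t0; apply/cvg_lim => //; exact: rd.
split; last exact: rdE.
have cV : continuous (fun z : R * R => V z.2).
  move=> z; apply: (@continuous_comp _ _ _ snd V); first exact: cvg_snd.
  exact: continuous_flux.
have cG : continuous (fun z : R * R => c * z.2 ^+ p - V z.2).
  move=> z; apply: cvgB; last exact: cV.
  apply: cvgM; first exact: cvg_cst.
  apply: (@continuous_comp _ _ _ snd (@GRing.exp R ^~ p)); first exact: cvg_snd.
  exact: exprn_continuous.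
have cx : continuous (fun z : R * R => z.1) by move=> z; exact: cvg_fst.
split.
- apply: (within_eq_continuous
    (f := fun z => u0 eta p z.1 z.2 - z.1 * (c * z.2 ^+ p - V z.2))).
    by move=> z [_ t0]; rewrite /u /Phi -/(J _) -JE// /a; ring.
  under eq_fun do rewrite u0E.
  move=> z; apply: cvgB; first exact: continuous_monomials2.
  by apply: cvgM; [exact: cx|exact: cG].
- by move=> x t _ t0; have [] := dut x t t0.
- by move=> x t _ _; have [] := dux x t.
- move=> x t _ _; rewrite -[derive1 (u ^~ t)]/(dx u ^~ t) dxE.
  by have [] := duxx x t.
- apply: (within_eq_continuous
    (f := fun z => u0t eta p z.1 z.2 - a * z.1 * V z.2)).
    by move=> z [_ t0]; rewrite dtE.
  move=> z; apply: cvgB; first exact: continuous_monomials2.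
  by apply: cvgM; [apply: cvgM; [exact: cvg_cst|exact: cx]|exact: cV].
- apply: (within_eq_continuous
    (f := fun z => u0x eta p z.1 z.2 - (c * z.2 ^+ p - V z.2))).
    by move=> z [_ t0]; rewrite (congr1 (@^~ z.1) (dxE z.2)) JE// ltW.
  by move=> z; apply: cvgB; [exact: continuous_monomials2|exact: cG].
- apply: (within_eq_continuous (f := fun z => u0xx eta p z.1 z.2)).
    by move=> z _; rewrite dxxE.
  exact: continuous_monomials2.
- by move=> t t0; apply/cvg_ex; exists (V t); exact: rd.
(* The caloric parts cancel, leaving -a x V, in which V is the flux by [rdE]. *)
- by move=> x t x0 t0; rewrite dtE// dxxE rdE// u0_heat /F /Phi /a; ring.
- move=> x x0; rewrite /u set_itv1 /Rintegral integral_set1 mulr0 subr0.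
  by rewrite u0_initial /h mE addn1.
- by move=> t t0; rewrite /u u0_boundary /Phi !mulr0 mul0r subr0.
Unshelve. all: by end_near.
Qed.
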